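(* Let $\nu$ be a rotationally invariant probability measure on $\mathbb{C}$ with $\int_{\mathbb{C}} |\log|z||\,d\nu(z)<\infty$, let $n\ge1$ and let $(x_1,\dots,x_n)$ be a jellium associated to $\nu$. Then, for any $\lambda>0$, $(\lambda x_1,\dots,\lambda x_n)$ has the law of a jellium associated to the measure $\nu(\cdot/\lambda)$, and $(i(x_1),\dots,i(x_n))$ has the law of a jellium associated to $i_*\nu$, the pushforward of $\nu$ by $i$, where $i:\mathbb{C}\setminus\{0\}\to\mathbb{C}\setminus\{0\}$ is the inversion $i(z)=1/z$.
   Context: For a rotationally invariant probability measure $\mu$ on $\mathbb{C}$ with $\int_{\mathbb{C}}|\log|z||\,d\mu(z)<\infty$, put $V^\mu(z)=\int_{\mathbb{C}}\log|z-w|\,d\mu(w)$. A jellium associated to $\mu$ is a random vector $(x_1,\dots,x_n)\in\mathbb{C}^n$ with law $\frac{1}{Z_n}\exp\left(-2\left[-\sum_{i<j}\log|x_i-x_j|+(n+1)\sum_{i=1}^n V^{\mu}(x_i)\right]\right)d\ell_{\mathbb{C}^n}(x_1,\dots,x_n)$, where $\ell_{\mathbb{C}^n}$ is Lebesgue measure on $\mathbb{C}^n$ and $Z_n$ is the normalizing constant. The measure $\nu(\cdot/\lambda)$ is $A\mapsto\nu(A/\lambda)$. The pushforward $i_*\nu$ is well-defined since $\nu$ has no atom at $0$ by the integrability assumption, and $(i(x_1),\dots,i(x_n))$ is almost surely well-defined. *)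

(* Defs.v *)
From HB Require Import structures.
From mathcomp Require Import all_boot all_order all_algebra.
From mathcomp Require Import complex.
From mathcomp Require Import all_classical all_reals all_analysis.
From mathcomp Require Import measurable_realfun.

Set Implicit Arguments.
Unset Strict Implicit.
Unset Printing Implicit Defensive.

Import Order.TTheory GRing.Theory Num.Theory.
Import ComplexField.Normc.

Local Open Scope classical_set_scope.
Local Open Scope ring_scope.
Local Open Scope ereal_scope.

(* R[i] carries the Borel sigma-algebra of R x R, transported along
   z |-> (Re z, Im z). The modulus is the R-valued normc: the ssrnum norm of
   R[i] takes its values in R[i]. *)
Section complex_measurable.
Context {R : realType}.

Definition pair_of_complex (z : R[i]) :
    measurableTypeR R * measurableTypeR R :=
  (complex.Re z, complex.Im z).

Definition complex_of_pair (p : measurableTypeR R * measurableTypeR R) : R[i] :=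
  Complex p.1 p.2.

Lemma pair_of_complexK : cancel pair_of_complex complex_of_pair.
Proof. by case. Qed.

Lemma complex_of_pairK : cancel complex_of_pair pair_of_complex.
Proof. by case. Qed.

HB.instance Definition _ := isPointed.Build R[i] (0%R : R[i]).

HB.instance Definition _ :=
  Measurable.copy R[i] (g_sigma_algebra_preimageType pair_of_complex).

Lemma measurable_pair_of_complex : measurable_fun [set: R[i]] pair_of_complex.
Proof. by move=> _ A mA; exists A. Qed.

Lemma measurable_complexP d (T : measurableType d) (f : T -> R[i]) :
  measurable_fun setT (pair_of_complex \o f) -> measurable_fun setT f.
Proof.
move=> mf _ _ [A mA <-]; rewrite !setTI.
by have := mf measurableT _ mA; rewrite setTI.
Qed.

Lemma measurable_complex_of_pair : measurable_fun setT complex_of_pair.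
Proof.
apply: measurable_complexP.
by rewrite (_ : _ \o _ = id)//; apply/funext => -[].
Qed.

Lemma measurable_Re : measurable_fun [set: R[i]] (@complex.Re R).
Proof. exact: (measurableT_comp measurable_fst measurable_pair_of_complex). Qed.

Lemma measurable_Im : measurable_fun [set: R[i]] (@complex.Im R).
Proof. exact: (measurableT_comp measurable_snd measurable_pair_of_complex). Qed.

End complex_measurable.

Lemma sigma_finite_pushforward d1 d2 (T1 : measurableType d1)
    (T2 : measurableType d2) (R : realType) (m : set T1 -> \bar R)
    (f : T1 -> T2) (g : T2 -> T1) : measurable_fun setT g -> cancel f g ->
  sigma_finite setT m -> sigma_finite setT (pushforward m f).
Proof.
move=> mg fK [F FT Foo].
exists (fun n => g @^-1` F n).
  by rewrite -preimage_bigcup -FT preimage_setT.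
move=> n; have [mF Fn] := Foo n; split.
  by rewrite -[X in measurable X]setTI; exact: mg.
rewrite /pushforward (_ : f @^-1` _ = F n)//.
by rewrite -comp_preimage; apply/seteqP; split=> x /=; rewrite fK.
Qed.

Lemma sigma_finite_product d1 d2 (T1 : measurableType d1)
    (T2 : measurableType d2) (R : realType)
    (m1 : {sigma_finite_measure set T1 -> \bar R})
    (m2 : {sigma_finite_measure set T2 -> \bar R}) :
  sigma_finite setT (m1 \x m2).
Proof.
have /sigma_finiteP[F [TF ndF Foo]] := sigma_finiteT m1.
have /sigma_finiteP[G [TG ndG Goo]] := sigma_finiteT m2.
exists (fun n => F n `*` G n).
  rewrite -setXTT TF TG predeqE => -[x y]; split.
    move=> [/= [n _ Fnx] [k _ Gky]]; exists (maxn n k) => //; split.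
    - by move: x Fnx; exact/subsetPset/ndF/leq_maxl.
    - by move: y Gky; exact/subsetPset/ndG/leq_maxr.
  by move=> [n _ []/= ? ?]; split; exists n.
move=> k; have [? ?] := Foo k; have [? ?] := Goo k.
split; first exact: measurableX.
by rewrite product_measure1E// lte_mul_pinfty// ge0_fin_numE.
Qed.

Section complex_lebesgue.
Context {R : realType}.

Definition lebesgueC : set R[i] -> \bar R :=
  pushforward (@lebesgue_measure R \x @lebesgue_measure R) complex_of_pair.

Let lebesgueC0 : lebesgueC set0 = 0.
Proof. by rewrite /lebesgueC /pushforward preimage_set0 measure0. Qed.

Let lebesgueC_ge0 A : 0 <= lebesgueC A.
Proof. exact: (measure_ge0 (@lebesgue_measure R \x @lebesgue_measure R)). Qed.

Let lebesgueC_sigma_additive : semi_sigma_additive lebesgueC.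
Proof.
by apply: measure_semi_sigma_additive; exact: measurable_complex_of_pair.
Qed.

HB.instance Definition _ := isMeasure.Build _ _ _ lebesgueC
  lebesgueC0 lebesgueC_ge0 lebesgueC_sigma_additive.

Let lebesgueC_sigma_finite : sigma_finite setT lebesgueC.
Proof.
apply: (sigma_finite_pushforward measurable_pair_of_complex complex_of_pairK).
exact: sigma_finite_product.
Qed.

HB.instance Definition _ := @Measure_isSigmaFinite.Build _ _ _
  lebesgueC lebesgueC_sigma_finite.

End complex_lebesgue.

(* Product of the Lebesgue measure on C with a measure on C^n, as a measure on
   C^(n+1). *)
Section complex_lebesgue_cons.
Context {R : realType} (n : nat).
Variable m : {sigma_finite_measure set (n.-tuple R[i]) -> \bar R}.

Definition tuple_cons (p : R[i] * n.-tuple R[i]) : n.+1.-tuple R[i] :=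
  [tuple of p.1 :: p.2].

Definition tuple_uncons (t : n.+1.-tuple R[i]) : R[i] * n.-tuple R[i] :=
  (thead t, [tuple of behead t]).

Lemma tuple_consK : cancel tuple_cons tuple_uncons.
Proof.
move=> [x t]; rewrite /tuple_uncons /tuple_cons theadE.
by congr (_, _); exact: val_inj.
Qed.

Lemma measurable_tuple_cons : measurable_fun setT tuple_cons.
Proof. exact: measurable_cons. Qed.

Lemma measurable_tuple_uncons : measurable_fun setT tuple_uncons.
Proof.
exact: (measurable_fun_pair (measurable_tnth _) (@measurable_behead _ _ _)).
Qed.

Definition lebesgueC_cons : set (n.+1.-tuple R[i]) -> \bar R :=
  pushforward (lebesgueC \x m) tuple_cons.

Let lebesgueC_cons0 : lebesgueC_cons set0 = 0.
Proof. by rewrite /lebesgueC_cons /pushforward preimage_set0 measure0. Qed.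

Let lebesgueC_cons_ge0 A : 0 <= lebesgueC_cons A.
Proof. exact: (measure_ge0 (lebesgueC \x m)). Qed.

Let lebesgueC_cons_sigma_additive : semi_sigma_additive lebesgueC_cons.
Proof.
by apply: measure_semi_sigma_additive; exact: measurable_tuple_cons.
Qed.

HB.instance Definition _ := isMeasure.Build _ _ _ lebesgueC_cons
  lebesgueC_cons0 lebesgueC_cons_ge0 lebesgueC_cons_sigma_additive.

Let lebesgueC_cons_sigma_finite : sigma_finite setT lebesgueC_cons.
Proof.
apply: (sigma_finite_pushforward measurable_tuple_uncons tuple_consK).
exact: sigma_finite_product.
Qed.

HB.instance Definition _ := @Measure_isSigmaFinite.Build _ _ _
  lebesgueC_cons lebesgueC_cons_sigma_finite.

End complex_lebesgue_cons.

(* Lebesgue measure on C^n; C^0 is a point, of mass 1. *)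
Fixpoint lebesgueCn {R : realType} (n : nat) :
    {sigma_finite_measure set (n.-tuple R[i]) -> \bar R} :=
  match n with
  | 0%N => \d_([tuple] : 0.-tuple R[i])
  | n'.+1 => lebesgueC_cons (lebesgueCn n')
  end.

Section jellium.
Context {R : realType}.
Implicit Types mu : probability R[i] R.

Definition rotation_invariant mu :=
  forall u : R[i], normc u = 1%R ->
  forall A : set R[i], measurable A ->
    mu [set (u * z)%R | z in A] = mu A.

(* The logarithm is lne, with lne 0 = -oo, rather than ln, with ln 0 = 0: an
   atom of mu at 0 makes this integral infinite. *)
Definition log_integrable mu := \int[mu]_z `|lne (normc z)%:E| < +oo.

Definition potential mu (z : R[i]) : \bar R :=
  \int[mu]_w lne (normc (z - w)%R)%:E.

Section weight.
Variables (mu : probability R[i] R) (n : nat).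
Implicit Type x : n.-tuple R[i].

Definition jellium_energy x : \bar R :=
  - (\sum_(i < n) \sum_(j < n | (i < j)%N)
       lne (normc (tnth x i - tnth x j)%R)%:E)
  + n.+1%:R%:E * \sum_(i < n) potential mu (tnth x i).

(* expeR (-oo) = 0, so the weight vanishes when two points coincide. *)
Definition jellium_weight x : \bar R := expeR ((-2)%:E * jellium_energy x).

Definition jellium_Z : \bar R := \int[lebesgueCn n]_x jellium_weight x.

(* If jellium_Z were 0 or +oo, the integral of the density would be 0, so that
   no random vector would have this law. *)
Definition jellium_density x : \bar R := jellium_weight x / jellium_Z.

End weight.

Definition is_jellium mu (n : nat) d (Omega : measurableType d)
    (P : probability Omega R) (X : Omega -> n.-tuple R[i]) : Prop :=
  [/\ rotation_invariant mu, log_integrable mu,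
      measurable_fun [set: Omega] X &
      forall A : set (n.-tuple R[i]), measurable A ->
        pushforward P X A = \int[lebesgueCn n]_(x in A) jellium_density mu x].

End jellium.

(* The measure nu (. / lam) : A |-> nu (A / lam). The proof of 0 < lam does not
   enter the values; it makes dilation a probability measure. *)
Section dilation.
Context {R : realType}.
Variables (lam : R) (lam_gt0 : (0 < lam)%R) (nu : probability R[i] R).

Definition scaleby (a : R) (z : R[i]) : R[i] := (real_complex R a * z)%R.

Lemma measurable_scaleby a : measurable_fun setT (scaleby a).
Proof.
apply: measurable_complexP; apply: measurable_fun_pair => /=.
- rewrite (_ : (fun _ => _) = fun z : R[i] => (a * complex.Re z)%R); last first.
    by apply/funext => -[x y] /=; rewrite mul0r subr0.
  by apply: measurable_funM => //; exact: measurable_Re.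
- rewrite (_ : (fun _ => _) = fun z : R[i] => (a * complex.Im z)%R); last first.
    by apply/funext => -[x y] /=; rewrite mul0r addr0.
  by apply: measurable_funM => //; exact: measurable_Im.
Qed.

Definition dilation & (0 < lam)%R : set R[i] -> \bar R :=
  fun A => nu [set (z / real_complex R lam)%R | z in A].

Let dilationE : dilation lam_gt0 = pushforward nu (scaleby lam).
Proof.
have lam0 : real_complex R lam != 0%R by rewrite fmorph_eq0 gt_eqF.
apply/funext => A; congr (nu _); apply/seteqP; split=> [_ [z Az <-]|z /= Az].
  by rewrite /= /scaleby mulrC divfK.
by exists (scaleby lam z) => //; rewrite /scaleby mulrC mulKf.
Qed.

Let dilation0 : dilation lam_gt0 set0 = 0.
Proof. by rewrite /dilation image_set0 measure0. Qed.

Let dilation_ge0 A : 0 <= dilation lam_gt0 A.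
Proof. exact: (measure_ge0 nu). Qed.

Let dilation_sigma_additive : semi_sigma_additive (dilation lam_gt0).
Proof.
rewrite dilationE.
by apply: measure_semi_sigma_additive; exact: measurable_scaleby.
Qed.

HB.instance Definition _ := isMeasure.Build _ _ _ (dilation lam_gt0)
  dilation0 dilation_ge0 dilation_sigma_additive.

Let dilation_setT : dilation lam_gt0 setT = 1.
Proof. by rewrite dilationE /pushforward preimage_setT probability_setT. Qed.

HB.instance Definition _ := Measure_isProbability.Build _ _ _
  (dilation lam_gt0) dilation_setT.

End dilation.

(* The inversion is totalized by 0^-1 = 0. This does not matter for the image
   of a log_integrable measure, which has no atom at 0. *)
Section inversion.
Context {R : realType}.

Definition inversion (z : R[i]) : R[i] := z^-1%R.

Let measurable_inversion : measurable_fun setT inversion.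
Proof.
have mR := @measurable_Re R; have mI := @measurable_Im R.
pose n2 (z : R[i]) := (complex.Re z ^+ 2 + complex.Im z ^+ 2)%R.
have mn2 : measurable_fun setT (fun z => (n2 z)^-1%R).
  rewrite (_ : (fun z => _) = fun z => (n2 z `^ (-1))%R); last first.
    by apply/funext => z; rewrite powR_inv1// addr_ge0 ?sqr_ge0.
  apply: (measurableT_comp (measurable_powR _)).
  by apply: measurable_funD; exact: measurable_funX.
apply: measurable_complexP; apply: measurable_fun_pair => /=.
- rewrite (_ : (fun _ => _) = fun z : R[i] => (complex.Re z * (n2 z)^-1)%R);
    last first.
    by apply/funext => -[x y].
  exact: measurable_funM.
- rewrite (_ : (fun _ => _) = fun z : R[i] => (- (complex.Im z * (n2 z)^-1))%R);
    last first.
    by apply/funext => -[x y].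
  by apply: measurableT_comp => //; exact: measurable_funM.
Qed.

HB.instance Definition _ := isMeasurableFun.Build _ _ _ _
  inversion measurable_inversion.

End inversion.

(* Main.v *)
Require Import Defs.
From HB Require Import structures.
From mathcomp Require Import all_boot all_order all_algebra.
From mathcomp Require Import complex.
From mathcomp Require Import all_classical all_reals all_analysis.
From mathcomp Require Import measurable_realfun.
From mathcomp Require Import ring.

(** Both maps of the statement, z |-> lam z and z |-> 1 / z, are Moebius maps,
    and the transport of the law uses nothing else about them. For a Moebius
    map phi put
    a z = ln |phi' z| / 2. Then

      |phi z - phi w| = e^(a z + a w) |z - w|,

    and the Jacobian of phi for the area measure is |phi'|^2 = e^(4 a). The
    function a is the constant ln lam / 2 for the dilation, and - ln |z| for
    the inversion.

    Let nu' be the image of nu by phi and b the integral of a with respect to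
    nu. Integrating the logarithm of the distance formula gives

      V^nu' (phi z) = V^nu z + a z + b       (potential_transport).

    In the energy of n points, the pair terms contribute
    - (n - 1) sum_i a (x_i), since each point belongs to n - 1 pairs, and the
    potential contributes (n + 1) (sum_i a (x_i) + n b). The energy of the
    image configuration is therefore the energy of x plus
    2 sum_i a (x_i) + n (n + 1) b (energy_transport). After multiplication by
    -2 and exponentiation, the non-constant factor is
    prod_i e^(- 4 a (x_i)), which is cancelled by the Jacobian of the change of
    variables on C^n: this is where the weight n + 1 of the potential matters.
    The constant factor is absorbed by the normalizing constant, which proves
    jellium_transport.

    These identities can only fail at points with a zero coordinate, which are
    negligible: the origin has area zero, and it is not an atom of nu by
    integrability of the logarithm. No finiteness of V^nu is needed:
    the potential may be -oo, and integralD_integrable_r and the arithmetic of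
    extended reals take care of this case.

    The remaining ingredient is the Jacobian of phi. For a complex dilation
    (ge0_integral_complexM) it is obtained by factoring the real linear map
    z |-> c z into affine changes of one real variable. For the inversion
    (ge0_integral_inversion) no differential calculus is needed, because the
    scaling law alone forces it: with h the indicator function of a set of
    area one, three successive scalings of one variable by the other, combined
    with Tonelli's theorem, turn

      int int h(y) f(x) dx dy   into   int int h(x) f(1/y) |y|^(-4) dx dy. *)

Set Implicit Arguments.
Unset Strict Implicit.
Unset Printing Implicit Defensive.

Import Order.TTheory GRing.Theory Num.Theory.
Import ComplexField.Normc.

Local Open Scope classical_set_scope.
Local Open Scope ring_scope.

(** * Affine changes of variable on the real line *)

Section affine_change_of_variable.
Context {R : realType}.
Implicit Types (a b : R) (f : R -> \bar R).
Local Notation mu := (@lebesgue_measure R).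
Local Open Scope ereal_scope.

(** The affine map x |-> a x + b, with values in the Borel space of R. *)
Definition affine a b (x : R) : measurableTypeR R := (a * x + b)%R.

Lemma measurable_affine a b :
  measurable_fun [set: measurableTypeR R] (affine a b).
Proof. by apply: measurable_funD => //; exact: measurable_funM. Qed.

Lemma lebesgue_measure_affine a b (A : set R) : (a != 0)%R -> measurable A ->
  mu A = `|a|%:E * mu (affine a b @^-1` A).
Proof.
move=> a0 mA.
pose m := mscale (NngNum (normr_ge0 a))
  (measure_function_pushforward__canonical__measure_function_Measure
     mu (measurable_affine a b)).
suff: mu A = m A by [].
apply: lebesgue_measure_unique mA => _ [[u v]] _ <-.
rewrite -[RHS]/(`|a|%:E * mu (affine a b @^-1` `]u, v]%classic)) /=.
rewrite lebesgue_measure_itv/= lte_fin.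
have [a_gt0|a_le0] := ltP 0%R a.
  rewrite (_ : _ @^-1` _ = `]((u - b) / a)%R, ((v - b) / a)%R]%classic);
    last first.
    apply/seteqP; split=> x /=; rewrite !in_itv/= /affine.
      by rewrite ltr_pdivrMr// ler_pdivlMr// ltrBlDr lerBrDr mulrC.
    by rewrite ltr_pdivrMr// ler_pdivlMr// ltrBlDr lerBrDr mulrC.
  rewrite lebesgue_measure_itv/= lte_fin ltr_pM2r ?invr_gt0// ltrD2r.
  case: ifPn => _; rewrite ?mule0//.
  rewrite -EFinB -EFinM gtr0_norm//; congr EFin; field.
  by rewrite gt_eqF.
have {a_le0}a_lt0 : (a < 0)%R by rewrite lt_neqAle a0.
rewrite (_ : _ @^-1` _ = `[((v - b) / a)%R, ((u - b) / a)%R[%classic);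
  last first.
  apply/seteqP; split=> x /=; rewrite !in_itv/= /affine andbC.
    by rewrite ltr_ndivlMr// ler_ndivrMr// ltrBlDr lerBrDr mulrC.
  by rewrite ltr_ndivlMr// ler_ndivrMr// ltrBlDr lerBrDr mulrC.
rewrite lebesgue_measure_itv/= lte_fin ltr_nM2r ?invr_lt0// ltrD2r.
case: ifPn => _; rewrite ?mule0//.
rewrite -EFinB -EFinM ltr0_norm//; congr EFin; field.
by rewrite lt_eqF.
Qed.

Lemma ge0_integral_affine a b f : (a != 0)%R ->
  measurable_fun [set: measurableTypeR R] f -> (forall x, 0 <= f x) ->
  \int[mu]_x (`|a|%:E * f (a * x + b)%R) = \int[mu]_x f x.
Proof.
move=> a0 mf f0.
pose nu := measure_function_pushforward__canonical__measure_function_Measure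
  mu (measurable_affine a b).
have mfa := measurableT_comp mf (measurable_affine a b).
rewrite ge0_integralZl ?lee_fin//.
transitivity (\int[mscale (NngNum (normr_ge0 a)) nu]_x f x).
  rewrite ge0_integral_mscale//= ge0_integral_pushforward//=.
  exact: measurable_affine.
apply: eq_measure_integral => A mA _.
by rewrite [RHS](lebesgue_measure_affine b a0).
Qed.

End affine_change_of_variable.

(** * Measurability and area on the complex plane *)

Section complex_functions.
Context {R : realType}.

Section measurability.
Context d (T : measurableType d).
Implicit Types f g : T -> R[i].

Lemma measurable_Complex (u v : T -> R) :
  measurable_fun [set: T] u -> measurable_fun [set: T] v ->
  measurable_fun [set: T] (fun t => Complex (u t) (v t)).
Proof.
by move=> mu mv; apply: measurable_complexP; exact: measurable_fun_pair.
Qed.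

Lemma measurable_fun_Re f :
  measurable_fun [set: T] f ->
  measurable_fun [set: T] (fun t => complex.Re (f t)).
Proof. exact: (measurableT_comp measurable_Re). Qed.

Lemma measurable_fun_Im f :
  measurable_fun [set: T] f ->
  measurable_fun [set: T] (fun t => complex.Im (f t)).
Proof. exact: (measurableT_comp measurable_Im). Qed.

Lemma measurable_complexB f g :
  measurable_fun [set: T] f -> measurable_fun [set: T] g ->
  measurable_fun [set: T] (fun t => f t - g t).
Proof.
move=> mf mg.
rewrite (_ : (fun _ => _) =
    fun t => Complex (complex.Re (f t) - complex.Re (g t))
                     (complex.Im (f t) - complex.Im (g t))); last first.
  by apply/funext => t; case: (f t) (g t) => [? ?] [].
by apply: measurable_Complex; apply: measurable_funB;
  (exact: measurable_fun_Re || exact: measurable_fun_Im).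
Qed.

Lemma measurable_complexM f g :
  measurable_fun [set: T] f -> measurable_fun [set: T] g ->
  measurable_fun [set: T] (fun t => f t * g t).
Proof.
move=> mf mg.
rewrite (_ : (fun _ => _) =
    fun t => Complex
      (complex.Re (f t) * complex.Re (g t) - complex.Im (f t) * complex.Im (g t))
      (complex.Re (f t) * complex.Im (g t) + complex.Im (f t) * complex.Re (g t)));
    last first.
  by apply/funext => t; case: (f t) (g t) => [? ?] [].
by apply: measurable_Complex; [apply: measurable_funB|apply: measurable_funD];
  apply: measurable_funM;
  (exact: measurable_fun_Re || exact: measurable_fun_Im).
Qed.

Lemma measurable_complexV f :
  measurable_fun [set: T] f -> measurable_fun [set: T] (fun t => (f t)^-1).
Proof. exact: (measurableT_comp (measurable_funPT inversion)). Qed.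

Lemma measurable_normc f :
  measurable_fun [set: T] f -> measurable_fun [set: T] (fun t => normc (f t)).
Proof.
move=> mf.
rewrite (_ : (fun _ => _) =
    fun t => (complex.Re (f t) ^+ 2 + complex.Im (f t) ^+ 2) `^ (1 / 2));
    last first.
  apply/funext => t; rewrite /normc; case: (f t) => x y /=.
  by rewrite div1r powR12_sqrt// addr_ge0// sqr_ge0.
apply: (measurableT_comp (measurable_powR _)).
by apply: measurable_funD; apply: measurable_funX;
  (exact: measurable_fun_Re || exact: measurable_fun_Im).
Qed.

End measurability.

Lemma normc_ge0 (z : R[i]) : 0 <= normc z.
Proof. by case: z => x y; exact: sqrtr_ge0. Qed.

Lemma normc_gt0 (z : R[i]) : z != 0 -> 0 < normc z.
Proof.
move=> z0; rewrite lt_neqAle normc_ge0 andbT eq_sym.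
by apply: contra_neq z0; exact: eq0_normc.
Qed.

Lemma measurable_set0C : measurable [set (0 : R[i])].
Proof.
exists ([set 0%R] `*` [set 0%R]); first exact: measurableX.
rewrite setTI; apply/seteqP; split=> [[x y] [/= -> ->//]|_ ->].
by split.
Qed.

End complex_functions.
#[global] Hint Resolve normc_ge0 measurable_set0C : core.

Section complex_lebesgue_integral.
Context {R : realType}.
Local Notation mu := (@lebesgue_measure R).
Local Notation lebC := (@lebesgueC R).
Implicit Types (f : R[i] -> \bar R) (z : R[i]).
Local Open Scope ereal_scope.

Let measurable_curried f : measurable_fun [set: R[i]] f ->
  measurable_fun [set: measurableTypeR R * measurableTypeR R]
    (f \o complex_of_pair).
Proof. by move=> mf; apply: measurableT_comp mf measurable_complex_of_pair. Qed.

Lemma ge0_integral_lebesgueC f :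
  measurable_fun [set: R[i]] f -> (forall z, 0 <= f z) ->
  \int[lebC]_z f z = \int[mu]_x \int[mu]_y f (Complex x y).
Proof.
move=> mf f0; rewrite ge0_integral_pushforward//=; last first.
  exact: measurable_complex_of_pair.
rewrite (@fubini_tonelli1 _ _ _ _ _ mu mu)//.
exact: measurable_curried.
Qed.

Lemma ge0_integral_lebesgueC_swap f :
  measurable_fun [set: R[i]] f -> (forall z, 0 <= f z) ->
  \int[lebC]_z f z = \int[mu]_y \int[mu]_x f (Complex x y).
Proof.
move=> mf f0; rewrite ge0_integral_lebesgueC//.
by rewrite (@fubini_tonelli _ _ _ _ _ mu mu (f \o complex_of_pair))//=;
  exact: measurable_curried.
Qed.

Lemma lebesgueC_rectangle (A B : set R) : measurable A -> measurable B ->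
  lebC [set z | A (complex.Re z) /\ B (complex.Im z)] = mu A * mu B.
Proof. by move=> mA mB; rewrite -product_measure1E. Qed.

Lemma lebesgueC_set0 : lebC [set 0%R] = 0.
Proof.
rewrite (_ : [set 0%R] =
    [set z | [set 0%R] (complex.Re z) /\ [set 0%R] (complex.Im z)]).
  by rewrite lebesgueC_rectangle// lebesgue_measure_set1 mule0.
by apply/seteqP; split=> [_ -> //|[x y] [/= -> ->]].
Qed.

End complex_lebesgue_integral.

(** * Multiplication by a complex number *)

Section complex_change_of_variable.
Context {R : realType}.
Local Notation mu := (@lebesgue_measure R).
Local Notation lebC := (@lebesgueC R).
Implicit Types (f : R[i] -> \bar R) (z c : R[i]).
Local Open Scope ereal_scope.

(** Multiplication by c = a + i b is a real linear map of determinant |c|^2. If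
    a is nonzero, it is the composition of the maps (x, y) |-> (a x - b y, y)
    and (X, y) |-> (X, b / a * X + (a^2 + b^2) / a * y), each of which is an
    affine map of a single coordinate. *)
Lemma ge0_integral_complexM c f : c != 0%R ->
  measurable_fun [set: R[i]] f -> (forall z, 0 <= f z) ->
  \int[lebC]_z ((normc c ^+ 2)%:E * f (c * z)%R) = \int[lebC]_z f z.
Proof.
case: c => a b c0 mf f0.
have nc2 : (normc (Complex a b) ^+ 2 = a ^+ 2 + b ^+ 2)%R.
  by rewrite sqr_sqrtr// addr_ge0// sqr_ge0.
have mf2 d (T : measurableType d) (u v : T -> R) :
    measurable_fun [set: T] u -> measurable_fun [set: T] v ->
    measurable_fun [set: T] (fun t => f (Complex (u t) (v t))).
  by move=> mu_ mv; exact: measurableT_comp mf (measurable_Complex mu_ mv).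
have mshift d (T : measurableType d) (k l : R) (u : T -> R) :
    measurable_fun [set: T] u ->
    measurable_fun [set: T] (fun t => k * u t + l)%R.
  by move=> ?; apply: measurable_funD => //; exact: measurable_funM.
have maff d (T : measurableType d) (k l : R) (u v : T -> R) :
    measurable_fun [set: T] u -> measurable_fun [set: T] v ->
    measurable_fun [set: T] (fun t => k * u t + l * v t)%R.
  by move=> ? ?; apply: measurable_funD; exact: measurable_funM.
rewrite [RHS]ge0_integral_lebesgueC//.
have [a0|a0] := eqVneq a 0%R.
  (* here z |-> c z is (x, y) |-> (- b y, b x) *)
  have b0 : (b != 0)%R by apply: contra_neq c0 => ->; rewrite a0.
  under [RHS]eq_integral => x _.
    rewrite -(@ge0_integral_affine _ b 0)//; last exact: mf2.
    over.
  rewrite (@fubini_tonelli _ _ _ _ _ mu mu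
    (fun p => `|b|%:E * f (Complex p.1 (b * p.2 + 0)%R)))//=; last 2 first.
  - by apply: measurable_funeM; apply: mf2 => //; exact: mshift.
  - by move=> p; rewrite mule_ge0 ?lee_fin.
  under [RHS]eq_integral => x _.
    rewrite -(@ge0_integral_affine _ (- b) 0) ?oppr_eq0//; last 2 first.
    - by apply: measurable_funeM; apply: mf2 => //; exact: mshift.
    - by move=> X; rewrite mule_ge0 ?lee_fin.
    over.
  rewrite [LHS]ge0_integral_lebesgueC; last 2 first.
  - apply: measurable_funeM; apply: measurableT_comp mf _.
    exact: measurable_complexM.
  - by move=> z; rewrite mule_ge0 ?lee_fin ?sqr_ge0.
  apply: eq_integral => x _; apply: eq_integral => y _ /=.
  rewrite muleA; congr (_ * f _).
    rewrite -EFinM nc2 a0 normrN -normrM -expr2 ger0_norm ?sqr_ge0//.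
    by rewrite expr0n add0r.
  by simpc; congr Complex; rewrite a0; ring.
pose k := ((a ^+ 2 + b ^+ 2) / a)%R.
have k0 : (k != 0)%R.
  by rewrite mulf_neq0 ?invr_eq0// gt_eqF// ltr_wpDr ?sqr_ge0// exprn_even_gt0.
under [RHS]eq_integral => x _.
  rewrite -(@ge0_integral_affine _ k (b / a * x))//; last exact: mf2.
  over.
rewrite (@fubini_tonelli _ _ _ _ _ mu mu
  (fun p => `|k|%:E * f (Complex p.1 (k * p.2 + b / a * p.1)%R)))//=;
    last 2 first.
  apply: measurable_funeM; apply: mf2 => //; exact: maff.
  by move=> p; rewrite mule_ge0 ?lee_fin.
under [RHS]eq_integral => y _.
  rewrite -(@ge0_integral_affine _ a (- b * y))//; last 2 first.
    apply: measurable_funeM; apply: mf2 => //.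
    by apply: measurable_funD => //; exact: measurable_funM.
    by move=> x; rewrite mule_ge0 ?lee_fin.
  over.
rewrite [LHS]ge0_integral_lebesgueC_swap; last 2 first.
- apply: measurable_funeM; apply: measurableT_comp mf _.
  exact: measurable_complexM.
- by move=> z; rewrite mule_ge0 ?lee_fin ?sqr_ge0.
apply: eq_integral => y _; apply: eq_integral => x _ /=.
rewrite muleA; congr (_ * f _).
  rewrite -EFinM nc2 -normrM mulrC divfK// ger0_norm// addr_ge0 ?sqr_ge0//.
by simpc; congr Complex; rewrite /k; field.
Qed.
End complex_change_of_variable.

(** * Inversion of the complex plane *)

Section complex_inversion.
Context {R : realType}.
Local Notation lebC := (@lebesgueC R).
Implicit Types (f : R[i] -> \bar R) (z c : R[i]).
Local Open Scope ereal_scope.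

(** The indicator function of the punctured plane, as a real factor that
    removes the origin from an integral. *)
Definition neq0C z : R := \1_(~` [set 0%R]) z.

Lemma neq0CE z : neq0C z = (z != 0%R)%:R.
Proof.
rewrite /neq0C indicE in_setC; congr (~~ _)%:R.
by apply/idP/eqP => [/set_mem//|->]; exact/mem_set.
Qed.

Lemma measurable_neq0C : measurable_fun [set: R[i]] neq0C.
Proof. by apply: measurable_indic; exact: measurableC. Qed.

(** A measure without atom at the origin does not see the factor neq0C. *)
Lemma ge0_integral_neq0C (m : {measure set R[i] -> \bar R}) f :
  m [set 0%R] = 0 -> measurable_fun [set: R[i]] f -> (forall z, 0 <= f z) ->
  \int[m]_z ((neq0C z)%:E * f z) = \int[m]_z f z.
Proof.
move=> m0 mf f0; apply: ge0_ae_eq_integral => //.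
- apply: emeasurable_funM => //; apply/measurable_EFinP.
  exact: measurable_neq0C.
- by move=> z _; rewrite mule_ge0// lee_fin.
- exists [set 0%R]; split => // z /= /not_implyP[_].
  apply: contra_notP => /eqP z0.
  by rewrite neq0CE z0 mul1e.
Qed.

(* The square must avoid the origin: h 0 = 0 is used below. *)
Let unit_square : set R[i] :=
  [set z | `]0%R, 1%R]%classic (complex.Re z) /\
           `]0%R, 1%R]%classic (complex.Im z)].

Let h z : R := \1_unit_square z.

Let measurable_unit_square : measurable unit_square.
Proof.
exists (`]0%R, 1%R]%classic `*` `]0%R, 1%R]%classic); first exact: measurableX.
by rewrite setTI.
Qed.

Let mh : measurable_fun [set: R[i]] h.
Proof. exact: measurable_indic. Qed.

Let h0 : h 0%R = 0%R.
Proof.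
by rewrite /h indicE memNset// => -[/=]; rewrite in_itv/= ltxx.
Qed.

Let integral_h : \int[lebC]_z (h z)%:E = 1.
Proof.
rewrite integral_indic// setIT [LHS]lebesgueC_rectangle//.
rewrite !lebesgue_measure_itv/=.
by rewrite lte01 sube0 mul1e.
Qed.

(** The inversion has Jacobian |z|^(-4). Only the scaling law
    ge0_integral_complexM is used: the double integral of h(y) f(x) is
    transformed by the substitutions x := x / y, y := x y and x := y x. At the
    origin 0^-1 = 0, so that the factor |z|^(-4) is 0 there. *)
Lemma ge0_integral_inversion f :
  measurable_fun [set: R[i]] f -> (forall z, 0 <= f z) ->
  \int[lebC]_z ((normc z ^- 4)%:E * f (z^-1)%R) = \int[lebC]_z f z.
Proof.
move=> mf f0.
rewrite -[RHS](ge0_integral_neq0C lebesgueC_set0)//.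
(* f1 and h vanish at 0, which makes the scalings by 0 harmless *)
set f1 := fun z => (neq0C z)%:E * f z.
have f10 z : 0 <= f1 z by rewrite mule_ge0// lee_fin.
have f1_0 : f1 0%R = 0 by rewrite /f1 neq0CE eqxx mul0e.
have mf1 : measurable_fun setT f1.
  apply: emeasurable_funM => //; apply/measurable_EFinP.
  exact: measurable_neq0C.
have hE0 z : 0 <= (h z)%:E by rewrite lee_fin.
have mR d (T : measurableType d) (u : T -> R[i]) : measurable_fun setT u ->
    measurable_fun setT (fun t => (h (u t))%:E).
  by move=> ?; apply/measurable_EFinP; exact: measurableT_comp mh _.
have mN d (T : measurableType d) (u : T -> R[i]) k : measurable_fun setT u ->
    measurable_fun setT (fun t => (normc (u t) ^- k)%:E).
  move=> mu_; apply/measurable_EFinP; under eq_fun do rewrite -exprVn -normcV.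
  apply: measurable_funX; apply: measurable_normc.
  exact: measurable_complexV.
transitivity (\int[lebC]_y \int[lebC]_x ((h y)%:E * f1 x)); last first.
  under eq_integral do rewrite ge0_integralZl//.
  by rewrite ge0_integralZr ?integral_h ?mul1e// ?integral_ge0//; exact: mR.
(* the substitution x := x / y *)
transitivity (\int[lebC]_y \int[lebC]_x
    ((h y * normc y ^- 2)%:E * f1 (x / y)%R)); last first.
  apply: eq_integral => y _; have [->|y0] := eqVneq y 0%R.
    by rewrite h0 mul0r; apply: eq_integral => x _; rewrite !mul0e.
  rewrite [RHS]ge0_integralZl//.
  rewrite -[X in _ = _ * X](@ge0_integral_complexM _ y^-1%R) ?invr_eq0//.
  rewrite -ge0_integralZl//; last 2 first.
  - apply: measurable_funeM; apply: measurableT_comp mf1 _.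
    exact: measurable_complexM.
  - by move=> x _; rewrite mule_ge0// lee_fin sqr_ge0.
  apply: eq_integral => x _.
  by rewrite EFinM normcV exprVn [(x / y)%R]mulrC -muleA.
rewrite -(@fubini_tonelli _ _ _ _ _ lebC lebC
  (fun p => (h p.2 * normc p.2 ^- 2)%:E * f1 (p.1 / p.2)%R))//=; last 2 first.
- apply: emeasurable_funM.
    under eq_fun do rewrite EFinM.
    by apply: emeasurable_funM; [exact: mR|exact: mN].
  apply: measurableT_comp mf1 _.
  by apply: measurable_complexM => //; exact: measurable_complexV.
- by move=> p; rewrite mule_ge0// lee_fin mulr_ge0// invr_ge0 sqr_ge0.
(* the substitution y := x * y *)
transitivity (\int[lebC]_x \int[lebC]_y
    ((h (x * y) * normc y ^- 2)%:E * f1 (y^-1)%R)); last first.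
  apply: eq_integral => x _; have [->|x0] := eqVneq x 0%R.
    by apply: eq_integral => y _; rewrite !mul0r h0 mul0r f1_0 mule0 mul0e.
  rewrite -[RHS](@ge0_integral_complexM _ x)//; last 2 first.
  - apply: emeasurable_funM; last first.
      apply: measurableT_comp mf1 _; apply: measurable_complexM => //.
      exact: measurable_complexV.
    under eq_fun do rewrite EFinM; apply: emeasurable_funM; last exact: mN.
    exact: mR.
  - by move=> y; rewrite mule_ge0// lee_fin mulr_ge0// invr_ge0 sqr_ge0.
  apply: eq_integral => y _; rewrite [RHS]muleA -EFinM.
  congr (_ * _); [congr EFin|congr f1].
    have nx0 := lt0r_neq0 (normc_gt0 x0).
    rewrite normcM exprMn (invfM (normc x ^+ 2)%R) [RHS]mulrCA; congr (_ * _)%R.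
    by rewrite mulrA divff ?mul1r// expf_neq0.
  by rewrite (invfM x) mulrA divff ?mul1r.
rewrite (@fubini_tonelli _ _ _ _ _ lebC lebC
  (fun p => (h (p.1 * p.2) * normc p.2 ^- 2)%:E * f1 (p.2^-1)%R))//=;
  last 2 first.
- apply: emeasurable_funM; last first.
    exact: (measurableT_comp mf1 (measurable_complexV measurable_snd)).
  under eq_fun do rewrite EFinM; apply: emeasurable_funM; last exact: mN.
  by apply: mR; exact: measurable_complexM.
- by move=> p; rewrite mule_ge0// lee_fin mulr_ge0// invr_ge0 sqr_ge0.
apply: eq_integral => y _; have [->|y0] := eqVneq y 0%R.
  rewrite invr0 f1_0 normc0 expr0n invr0 mul0e.
  under eq_integral do rewrite mule0.
  by rewrite integral0.
(* the substitution x := y * x *)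
rewrite [f1]lock; under eq_integral do rewrite EFinM -muleA.
rewrite -lock ge0_integralZr//; last 2 first.
- by apply: mR; exact: measurable_complexM.
- by rewrite mule_ge0// lee_fin invr_ge0 sqr_ge0.
transitivity ((normc y ^- 2)%:E * ((normc y ^- 2)%:E * f1 (y^-1)%R)).
  by rewrite /f1 neq0CE invr_eq0 y0 mul1e muleA -EFinM -invfM -exprD.
congr (_ * _); have mhy : measurable_fun setT (fun x => (h (y * x))%:E).
  by apply: mR; exact: measurable_complexM.
rewrite -[LHS]mule1 -integral_h.
rewrite -(@ge0_integral_complexM _ y (EFin \o h))//=; last first.
  exact: measurableT_comp.
rewrite -ge0_integralZl//; last 3 first.
- exact: measurable_funeM.
- by move=> x _; rewrite mule_ge0// lee_fin sqr_ge0.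
- by rewrite lee_fin invr_ge0 sqr_ge0.
apply: eq_integral => x _; rewrite [(x * y)%R]mulrC muleA -EFinM mulVf ?mul1r//.
by rewrite expf_neq0// gt_eqF// normc_gt0.
Qed.
End complex_inversion.

(** * Changes of variable on C^n *)

Section lebesgueCn_integral.
Context {R : realType}.
Local Open Scope ereal_scope.

(** Tonelli's theorem on C^(n+1) = C x C^n. *)
Lemma ge0_integral_lebesgueCnS n (f : n.+1.-tuple R[i] -> \bar R) :
  measurable_fun [set: n.+1.-tuple R[i]] f -> (forall x, 0 <= f x) ->
  \int[lebesgueCn n.+1]_x f x =
  \int[lebesgueC]_z \int[lebesgueCn n]_t f (tuple_cons (z, t)).
Proof.
move=> mf f0.
rewrite (@ge0_integral_pushforward _ _ _ _ _ (@tuple_cons R n)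
  (@measurable_tuple_cons R n) (lebesgueC \x lebesgueCn n))//.
rewrite preimage_setT fubini_tonelli1//; last by move=> p; exact: f0.
exact: measurableT_comp mf (@measurable_tuple_cons R n).
Qed.

Lemma measurable_map_tuple (n : nat) (phi : R[i] -> R[i]) :
  measurable_fun [set: R[i]] phi ->
  measurable_fun [set: n.-tuple R[i]] (map_tuple phi : _ -> n.-tuple R[i]).
Proof.
move=> mphi; apply/measurable_fun_tnthP => i.
rewrite (_ : _ \o _ = phi \o (@tnth n R[i] ^~ i)).
  by apply: measurableT_comp mphi _; exact: measurable_tnth.
by apply/funext => x /=; rewrite tnth_map.
Qed.

Lemma measurable_prod_tnth n (J : R[i] -> R) :
  measurable_fun [set: R[i]] J ->
  measurable_fun [set: n.-tuple R[i]] (fun x => \prod_(i < n) J (tnth x i))%R.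
Proof.
move=> mJ; apply: measurable_prod => i _.
exact: measurableT_comp mJ (measurable_tnth _).
Qed.

(** A change of variables phi of C, with Jacobian J, acts on C^n coordinate by
    coordinate, with the product of the Jacobians as Jacobian. *)
Lemma ge0_integral_map_tuple (phi : R[i] -> R[i]) (J : R[i] -> R) :
  measurable_fun [set: R[i]] phi -> measurable_fun [set: R[i]] J ->
  (forall z, (0 <= J z)%R) ->
  (forall f : R[i] -> \bar R, measurable_fun [set: R[i]] f ->
    (forall z, 0 <= f z) ->
    \int[lebesgueC]_z ((J z)%:E * f (phi z)) = \int[lebesgueC]_z f z) ->
  forall n (f : n.-tuple R[i] -> \bar R),
    measurable_fun [set: n.-tuple R[i]] f -> (forall x, 0 <= f x) ->
    \int[lebesgueCn n]_x ((\prod_(i < n) J (tnth x i))%:E * f (map_tuple phi x))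
    = \int[lebesgueCn n]_x f x.
Proof.
move=> mphi mJ J0 phiJ; elim=> [|n IHn] f mf f0.
  apply: eq_integral => x _; rewrite big_ord0 mul1e [x]tuple0.
  by rewrite [map_tuple _ _]tuple0.
have mcons : measurable_fun setT (f \o @tuple_cons R n).
  exact: measurableT_comp mf (@measurable_tuple_cons R n).
rewrite !ge0_integral_lebesgueCnS//; last 2 first.
- apply: emeasurable_funM.
    by apply/measurable_EFinP; exact: measurable_prod_tnth.
  exact: (measurableT_comp mf (measurable_map_tuple mphi)).
- by move=> x; rewrite mule_ge0// lee_fin prodr_ge0.
rewrite -[RHS]phiJ; last 2 first.
- exact: (measurable_fun_fubini_tonelli_F _ mcons (fun p => f0 _)).
- by move=> z; exact: integral_ge0.
apply: eq_integral => z _.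
have mfz c : measurable_fun setT (fun t => f (tuple_cons (c, t))).
  apply: measurableT_comp mcons _.
  exact: measurable_fun_pair (measurable_cst c) (@measurable_id _ _ _).
rewrite -(IHn (fun t => f (tuple_cons (phi z, t))))//.
rewrite -ge0_integralZl//; last 3 first.
- apply: emeasurable_funM.
    by apply/measurable_EFinP; exact: measurable_prod_tnth.
  exact: (measurableT_comp (mfz (phi z)) (measurable_map_tuple mphi)).
- by move=> x _; rewrite mule_ge0// lee_fin prodr_ge0.
- by rewrite lee_fin.
apply: eq_integral => t _; rewrite muleA -EFinM big_ord_recl.
congr (_%:E * f _).
  by congr (_ * _)%R; apply: eq_bigr => i _; rewrite /tuple_cons tnthS.
exact: val_inj.
Qed.

End lebesgueCn_integral.

(** * Additivity of the integral when one term only is integrable *)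

Section integralD_nonintegrable.
Local Open Scope ereal_scope.
Context d (T : measurableType d) {R : realType}.
Variable m : {measure set T -> \bar R}.
Implicit Types (f : T -> \bar R) (g : T -> R).

Let integrable_opp g : m.-integrable [set: T] (EFin \o g) ->
  m.-integrable [set: T] (EFin \o (\- g)%R).
Proof. by move=> /integrableN; exact: eq_integrable. Qed.

Let funeposD_lty f g : measurable_fun [set: T] f ->
  m.-integrable [set: T] (EFin \o g) -> \int[m]_x f^\+ x < +oo ->
  \int[m]_x (f \+ (EFin \o g))^\+ x < +oo.
Proof.
move=> mf ig foo; have mg := measurable_int _ ig.
apply: (@le_lt_trans _ _ (\int[m]_x (f^\+ x + (EFin \o g)^\+ x))).
  apply: ge0_le_integral => //.
  - by apply: measurable_funepos; exact: emeasurable_funD.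
  - by apply: emeasurable_funD; exact: measurable_funepos.
  - move=> x _; rewrite funeposE ge_max !funeposE leeD ?le_max ?lexx//=.
    by rewrite adde_ge0// le_max lexx orbT.
rewrite ge0_integralD//; [|exact: measurable_funepos..].
by rewrite lte_add_pinfty// integral_funepos_lt_pinfty.
Qed.

Let funeposD_ltyP f g : measurable_fun [set: T] f ->
  m.-integrable [set: T] (EFin \o g) ->
  (\int[m]_x (f \+ (EFin \o g))^\+ x < +oo) = (\int[m]_x f^\+ x < +oo).
Proof.
move=> mf ig; apply/idP/idP => [|]; last exact: funeposD_lty.
have igN : m.-integrable setT (EFin \o (\- g)%R) by exact: integrable_opp.
have mfg : measurable_fun setT (f \+ (EFin \o g)).
  by apply: emeasurable_funD => //; exact: measurable_int ig.
have fE : (f \+ (EFin \o g)) \+ (EFin \o (\- g)%R) = f.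
  by apply/funext => x /=; rewrite EFinN addeK.
by move=> /(funeposD_lty mfg igN); rewrite fE.
Qed.

Let funenegD_ltyP f g : measurable_fun [set: T] f ->
  m.-integrable [set: T] (EFin \o g) ->
  (\int[m]_x (f \+ (EFin \o g))^\- x < +oo) = (\int[m]_x f^\- x < +oo).
Proof.
move=> mf ig.
rewrite -!funeposN (_ : \- (f \+ _) = \- f \+ (EFin \o (\- g)%R)).
  rewrite funeposD_ltyP//; last exact: integrable_opp.
  exact: measurableT_comp.
by apply/funext => x /=; rewrite fin_num_oppeD.
Qed.

(** The integral of an extended-real function is the difference of the
    integrals of its positive and negative parts, with +oo - oo = -oo. Adding
    an integrable function does not change which of the two is infinite, so
    that additivity holds with no assumption on f besides measurability. *)
Lemma integralD_integrable_r f g : measurable_fun [set: T] f ->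
  m.-integrable [set: T] (EFin \o g) ->
  \int[m]_x (f x + (g x)%:E) = \int[m]_x f x + \int[m]_x (g x)%:E.
Proof.
move=> mf ig; have := funeposD_ltyP mf ig; have := funenegD_ltyP mf ig.
have ifin := integrable_fin_num measurableT ig.
rewrite ![\int[m]_x (_ + _)]integralE ![\int[m]_x f x]integralE.
have [fp|] := ltP (\int[m]_x f^\+ x) +oo;
  have [fn|] := ltP (\int[m]_x f^\- x) +oo.
- move=> _ _; rewrite -!integralE integralD//; apply/integrableP; split=> //.
  under eq_integral do rewrite -[`|_|]/((abse \o f) _) fune_abse.
  rewrite ge0_integralD//; [|exact: measurable_funepos|
    exact: measurable_funeneg].
  by rewrite lte_add_pinfty.
- rewrite leye_eq => /eqP -> /negbT; rewrite -leNgt leye_eq => /eqP -> _.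
  by rewrite !addeNy ?addNye.
- rewrite leye_eq => fpy fgn /negbT; rewrite -leNgt leye_eq => /eqP ->.
  have oppNy (x : \bar R) : x < +oo -> - x != -oo by case: x.
  by move: fpy => /eqP ->; rewrite !addye// ?oppNy//; case: (\int[m]_x _) ifin.
- rewrite leye_eq => /eqP -> _ /negbT; rewrite -leNgt leye_eq => /eqP ->.
  by rewrite !addeNy ?addNye.
Qed.
End integralD_nonintegrable.

(** * Measurability of the weight of a jellium *)

Section jellium_measurability.
Context {R : realType}.
Local Open Scope ereal_scope.

Lemma measurable_lne d (T : measurableType d) (r : T -> R) :
  measurable_fun [set: T] r -> measurable_fun [set: T] (fun t => lne (r t)%:E).
Proof.
move=> mr; rewrite /lne; apply: measurable_fun_ifT => //.
  by apply: measurable_fun_ler.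
apply/measurable_EFinP; apply: measurableT_comp mr.
exact: measurable_ln.
Qed.

(** The case r = 0, where both sides are -oo, is included. *)
Lemma lne_expRM (s r : R) : (0 <= r)%R ->
  lne (expR s * r)%:E = lne r%:E + s%:E.
Proof.
rewrite le_eqVlt => /predU1P[<-|r0]; first by rewrite mulr0 !le0_lneNy.
rewrite !lne_EFin ?mulr_gt0 ?expR_gt0// lnM ?posrE ?expR_gt0// expRK.
by rewrite addrC EFinD.
Qed.

Variable mu : probability R[i] R.

Lemma measurable_log_kernel :
  measurable_fun [set: R[i] * R[i]] (fun p => lne (normc (p.1 - p.2)%R)%:E).
Proof.
apply: measurable_lne; apply: measurable_normc; exact: measurable_complexB.
Qed.

Lemma measurable_potential : measurable_fun [set: R[i]] (potential mu).
Proof.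
rewrite (_ : potential mu = fun z =>
    \int[mu]_w ((fun p => lne (normc (p.1 - p.2)%R)%:E)^\+ (z, w)) -
    \int[mu]_w ((fun p => lne (normc (p.1 - p.2)%R)%:E)^\- (z, w))).
  apply: emeasurable_funB.
    apply: (measurable_fun_fubini_tonelli_F _
      (measurable_funepos measurable_log_kernel)) => p.
    exact: funepos_ge0.
  apply: (measurable_fun_fubini_tonelli_F _
    (measurable_funeneg measurable_log_kernel)) => p.
  exact: funeneg_ge0.
by apply/funext => z; rewrite /potential integralE; congr (_ - _);
  apply: eq_integral => w _; rewrite !(funeposE, funenegE).
Qed.

Lemma measurable_jellium_weight n :
  measurable_fun [set: n.-tuple R[i]] (jellium_weight mu (n := n)).
Proof.
have mexpeR : measurable_fun [set: \bar R] (@expeR R).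
  rewrite (_ : @expeR R = fun x => maxe (er_map expR x) 0).
    apply: measurable_maxe => //.
    apply: (@measurable_er_map _ (measurableTypeR R)).
    exact: measurable_expR.
  apply/funext => -[r| |]/=; last 2 first.
  - by rewrite maxye.
  - by rewrite maxNye.
  - by rewrite max_l// lee_fin expR_ge0.
apply: measurableT_comp mexpeR _; apply: measurable_funeM.
apply: emeasurable_funD.
  apply: measurableT_comp => //; apply: emeasurable_sum => i.
  under eq_fun do rewrite big_mkcond/=.
  apply: emeasurable_sum => j; case: (i < j)%N => //.
  apply: measurable_lne; apply: measurable_normc.
  by apply: measurable_complexB; exact: measurable_tnth.
apply: measurable_funeM; apply: emeasurable_sum => i.
exact: measurableT_comp measurable_potential (measurable_tnth _).
Qed.

Lemma jellium_weight_ge0 n (x : n.-tuple R[i]) : 0 <= jellium_weight mu x.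
Proof. exact: expeR_ge0. Qed.

End jellium_measurability.

Section sums.
Context {R : realType}.

(** Each index belongs to n - 1 pairs i < j. *)
Lemma sum_ord_pairs n (c : 'I_n -> R) :
  \sum_(i < n) \sum_(j < n | (i < j)%N) (c i + c j) =
  (\sum_(i < n) c i) *+ n.-1.
Proof.
under eq_bigr do rewrite big_split/=.
rewrite big_split/= [X in _ + X](exchange_big_dep xpredT)//= -big_split/=.
rewrite -sumrMnl; apply: eq_bigr => i _.
rewrite -[n in RHS]card_ord -(cardC1 i) -sumr_const.
rewrite [RHS](bigID [pred j : 'I_n | (i < j)%N])/=.
congr (_ + _); apply: eq_bigl => j.
  by rewrite !inE -val_eqE/=; case: ltngtP.
by rewrite !inE -val_eqE/=; case: ltngtP.
Qed.

Local Open Scope ereal_scope.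

Lemma sumeD_EFin (I : Type) (s : seq I) (Q : pred I) (x : I -> \bar R)
    (r : I -> R) :
  \sum_(i <- s | Q i) (x i + (r i)%:E) =
  \sum_(i <- s | Q i) x i + (\sum_(i <- s | Q i) r i)%:E.
Proof. by rewrite big_split/= sumEFin. Qed.

End sums.

(** * Transport of a jellium *)

(** In this section phi is a map of C, the function a stands for
    ln |phi'| / 2, and nu' is the image of nu by phi. The two hypotheses on phi
    and a are the distance formula of Moebius maps and the value e^(4 a) of the
    Jacobian. *)
Section transport.
Context {R : realType}.
Local Open Scope ereal_scope.
Variables (nu nu' : probability R[i] R) (phi : R[i] -> R[i]) (a : R[i] -> R).
Hypothesis mphi : measurable_fun [set: R[i]] phi.
Hypothesis phi_dist : forall z w : R[i], z != 0%R -> w != 0%R ->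
  normc (phi z - phi w)%R = (expR (a z + a w) * normc (z - w))%R.
Hypothesis phi_lebesgueC : forall f : R[i] -> \bar R,
  measurable_fun [set: R[i]] f -> (forall z, 0 <= f z) ->
  \int[lebesgueC]_z ((expR (4 * a z)%R)%:E * f (phi z)) = \int[lebesgueC]_z f z.
Hypothesis nu'E : forall A, measurable A -> nu' A = nu (phi @^-1` A).
Hypothesis nu_set0 : nu [set 0%R] = 0.
Hypothesis ia : nu.-integrable [set: R[i]] (EFin \o a).

Let ma : measurable_fun [set: R[i]] a.
Proof. exact/measurable_EFinP/(measurable_int _ ia). Qed.

Lemma integral_image_measure (f : R[i] -> \bar R) :
  measurable_fun [set: R[i]] f -> \int[nu']_z f z = \int[nu]_z f (phi z).
Proof.
move=> mf.
have E (g : R[i] -> \bar R) : measurable_fun [set: R[i]] g ->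
    (forall z, 0 <= g z) -> \int[nu']_z g z = \int[nu]_z g (phi z).
  move=> mg g0; transitivity (\int[pushforward nu phi]_z g z).
    by apply: eq_measure_integral => A mA _; exact: nu'E.
  by rewrite ge0_integral_pushforward.
rewrite integralE [RHS]integralE !E//; last 2 first.
- exact: measurable_funeneg.
- exact: measurable_funepos.
by congr (_ - _); apply: eq_integral => z _; rewrite !(funeposE, funenegE).
Qed.

(* The constant b of the potential, a finite integral. *)
Let b : R := fine (\int[nu]_w (a w)%:E).

(** The integral over w of ln |phi z - phi w| = ln |z - w| + a z + a w. *)
Lemma potential_transport (z : R[i]) : z != 0%R ->
  potential nu' (phi z) = potential nu z + (a z + b)%:E.
Proof.
move=> z0; have mk c := measurable_lne (measurable_normc
  (measurable_complexB (measurable_cst c) (@measurable_id _ R[i] setT))).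
rewrite {1}/potential integral_image_measure; last exact: mk.
have ifin := integrable_fin_num measurableT ia.
transitivity (\int[nu]_w (lne (normc (z - w)%R)%:E + (a z + a w)%:E)).
  apply: ae_eq_integral => //.
  - exact: measurableT_comp (mk _) mphi.
  - apply: emeasurable_funD; first exact: mk.
    by apply/measurable_EFinP; exact: measurable_funD.
  - exists [set 0%R]; split => // w; apply: contra_notP => /eqP w0 _.
    by rewrite phi_dist// lne_expRM// normc_ge0.
have iaz : nu.-integrable setT (EFin \o cst (a z)).
  exact: finite_measure_integrable_cst.
rewrite (integralD_integrable_r (f := fun w : R[i] => lne (normc (z - w)%R)%:E)
  (g := fun w => (a z + a w)%R)); last 2 first.
- exact: mk.
- exact: (integrableD _ iaz ia).
congr (_ + _); rewrite EFinD.
under eq_integral do rewrite EFinD.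
rewrite (integralD _ iaz ia)//; congr (_ + _); last by rewrite /b fineK.
rewrite [LHS](@integral_cst _ _ _ nu _ _ (a z)%:E)//.
by rewrite [X in _ * X]probability_setT mule1.
Qed.

Lemma energy_transport n (x : n.-tuple R[i]) :
  (forall i, tnth x i != 0%R) ->
  jellium_energy nu' (map_tuple phi x) = jellium_energy nu x +
    (2 * (\sum_(i < n) a (tnth x i)) + n.+1%:R * (n%:R * b))%R%:E.
Proof.
move=> x0; rewrite /jellium_energy.
under eq_bigr => i _.
  under eq_bigr => j _ do
    rewrite !tnth_map phi_dist// lne_expRM ?normc_ge0//.
  rewrite sumeD_EFin.
  over.
rewrite sumeD_EFin sum_ord_pairs.
under [X in _ * X]eq_bigr => i _ do rewrite tnth_map potential_transport//.
rewrite sumeD_EFin fin_num_oppeD// muleDr//; last exact: fin_num_adde_defl.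
have -> : (\sum_(i < n) (a (tnth x i) + b) =
    \sum_(i < n) a (tnth x i) + n%:R * b)%R.
  by rewrite big_split/= big_const_ord iter_addr addr0 mulr_natl.
set S := \sum_(i < n) \sum_(j < n | _) _.
set V := \sum_(i < n) _; set A := (\sum_(i < n) _)%R.
rewrite -!addeA; congr (_ + _); rewrite addeCA; congr (_ + _).
rewrite -EFinM -EFinN -EFinD; congr EFin.
rewrite mulrDr -mulr_natl addrA; congr (_ + _)%R.
rewrite {}/A {S V}; case: n x x0 => [|n] x x0.
  by rewrite big_ord0 !mulr0 oppr0 addr0.
by rewrite /= -[n.+2]addn2 natrD; ring.
Qed.

(* The Jacobian, set to 0 at the origin, where the distance formula fails. *)
Let J z : R := (neq0C z * expR (4 * a z))%R.

Let neq0n n (x : n.-tuple R[i]) : R := (\prod_(i < n) neq0C (tnth x i))%R.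

Let J_lebesgueC (f : R[i] -> \bar R) :
  measurable_fun [set: R[i]] f -> (forall z, 0 <= f z) ->
  \int[lebesgueC]_z ((J z)%:E * f (phi z)) = \int[lebesgueC]_z f z.
Proof.
move=> mf f0; rewrite -[RHS]phi_lebesgueC//.
rewrite -[RHS](ge0_integral_neq0C lebesgueC_set0).
- by apply: eq_integral => z _; rewrite muleA -EFinM.
- apply: emeasurable_funM; last exact: (measurableT_comp mf mphi).
  apply/measurable_EFinP; apply: measurableT_comp; first exact: measurable_expR.
  exact: measurable_funM.
- by move=> z; rewrite mule_ge0// lee_fin expR_ge0.
Qed.

(* The ratio of the normalizing constants. *)
Let C n : R := expR (- 2 * (n.+1%:R * (n%:R * b)))%R.

(** The weight of the image configuration, times the Jacobian, is a constant
    multiple of the weight. Both sides vanish if a coordinate is zero. *)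
Lemma weight_transport n (x : n.-tuple R[i]) :
  (\prod_(i < n) J (tnth x i))%:E * jellium_weight nu' (map_tuple phi x) =
  (C n)%:E * ((neq0n x)%:E * jellium_weight nu x).
Proof.
rewrite /J big_split/= -/(neq0n x).
have [x0|/existsNP[i xi0]] := pselect (forall i, tnth x i != 0%R); last first.
  have -> : neq0n x = 0%R.
    rewrite /neq0n (bigD1 i)//= neq0CE.
    by move/negP: xi0 => /negbTE ->; rewrite mul0r.
  by rewrite mul0r !mul0e mule0.
have -> : neq0n x = 1%R.
  by rewrite /neq0n big1// => i _; rewrite neq0CE x0.
rewrite mul1r mul1e -expR_sum -mulr_sumr /jellium_weight energy_transport//.
rewrite muleDr//; last exact: fin_num_adde_defl.
rewrite expeRD [LHS]muleC -muleA [RHS]muleC; congr (_ * _).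
set r := (2 * _ + _)%R.
rewrite -[expeR _]/(expR (- 2 * r))%:E -EFinM -expRD /C; congr (expR _)%:E.
by rewrite /r; ring.
Qed.

Lemma ge0_integral_weight_transport n (g : n.-tuple R[i] -> \bar R) :
  measurable_fun [set: n.-tuple R[i]] g -> (forall x, 0 <= g x) ->
  \int[lebesgueCn n]_x (g x * jellium_weight nu' x) =
  (C n)%:E * \int[lebesgueCn n]_x (g (map_tuple phi x) * jellium_weight nu x).
Proof.
move=> mg g0.
have mgphi : measurable_fun setT (fun x : n.-tuple R[i] => g (map_tuple phi x)).
  exact: (measurableT_comp mg (measurable_map_tuple mphi)).
have mneq0 : measurable_fun setT (fun x : n.-tuple R[i] => (neq0n x)%:E).
  apply/measurable_EFinP; apply: measurable_prod_tnth; exact: measurable_neq0C.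
have neq0n_ge0 (x : n.-tuple R[i]) : 0 <= (neq0n x)%:E.
  by rewrite lee_fin prodr_ge0.
have gw0 (mu : probability R[i] R) (h : n.-tuple R[i] -> n.-tuple R[i]) x :
    0 <= g (h x) * jellium_weight mu x.
  by rewrite mule_ge0// jellium_weight_ge0.
have mgw : measurable_fun setT (fun x : n.-tuple R[i] =>
    g (map_tuple phi x) * jellium_weight nu x).
  by apply: emeasurable_funM => //; exact: measurable_jellium_weight.
rewrite -[LHS](ge0_integral_map_tuple mphi _ _ J_lebesgueC); last 4 first.
- apply: measurable_funM; first exact: measurable_neq0C.
  apply: measurableT_comp; first exact: measurable_expR.
  exact: measurable_funM.
- by move=> z; rewrite mulr_ge0// expR_ge0.
- by apply: emeasurable_funM => //; exact: measurable_jellium_weight.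
- exact: (gw0 _ id).
rewrite -[X in _ = _ * X](ge0_integral_map_tuple (phi := id) (J := neq0C))//;
  last 2 first.
- exact: measurable_neq0C.
- by move=> f mf f0; exact: ge0_integral_neq0C lebesgueC_set0 mf f0.
have map_id_tuple (x : n.-tuple R[i]) : map_tuple id x = x.
  by apply: val_inj; exact: map_id.
under [X in _ = _ * X]eq_integral do rewrite map_id_tuple.
rewrite -ge0_integralZl//; last 3 first.
- exact: emeasurable_funM.
- by move=> x _; rewrite mule_ge0//; exact: neq0n_ge0.
- by rewrite lee_fin expR_ge0.
apply: eq_integral => x _.
by rewrite muleCA weight_transport muleCA; congr (_ * _); rewrite muleCA.
Qed.

(** The cases x = 0 and x = +oo, where the inverses are +oo and 0, are included:
    the normalizing constant need not be known to be finite and nonzero. *)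
Lemma inve_EFinM (c : R) (x : \bar R) : (0 < c)%R -> 0 <= x ->
  (c%:E * x)^-1 = c^-1%:E * x^-1.
Proof.
move=> c0; case: x => [r| |]// _; last first.
  by rewrite gt0_muley ?lte_fin// invey mule0.
rewrite -EFinM !inver mulf_eq0 gt_eqF//=; case: ifPn => // _.
  by rewrite gt0_muley ?lte_fin ?invr_gt0.
by rewrite invfM.
Qed.

Lemma jellium_transport n d (Omega : measurableType d) (P : probability Omega R)
    (X : Omega -> n.-tuple R[i]) :
  rotation_invariant nu' -> log_integrable nu' ->
  is_jellium nu P X -> is_jellium nu' P (fun w => map_tuple phi (X w)).
Proof.
move=> rot' log' [_ _ mX PX].
have mphin := measurable_map_tuple (n := n) mphi.
split; [exact: rot'|exact: log'|exact: (measurableT_comp mphin mX)|].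
have C0 : (0 < C n)%R by exact: expR_gt0.
have ZE : jellium_Z nu' n = (C n)%:E * jellium_Z nu n.
  have := @ge0_integral_weight_transport n (cst 1) (measurable_cst _)
    (fun=> lee01).
  under eq_integral do rewrite mul1e.
  by under [X in _ * X]eq_integral do rewrite mul1e.
have iZ0 mu : 0 <= (jellium_Z mu n)^-1.
  by rewrite inve_ge0 integral_ge0// => x _; exact: jellium_weight_ge0.
have densityE mu (A : set (n.-tuple R[i])) : measurable A ->
    \int[lebesgueCn n]_(x in A) jellium_density mu x =
    \int[lebesgueCn n]_x ((\1_A x)%:E * jellium_weight mu x) / jellium_Z mu n.
  move=> mA; rewrite integral_mkcond -ge0_integralZr//; last 2 first.
  - apply: emeasurable_funM; last exact: measurable_jellium_weight.
    by apply/measurable_EFinP; exact: measurable_indic.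
  - by move=> x _; rewrite mule_ge0// ?lee_fin// jellium_weight_ge0.
  apply: eq_integral => x _; rewrite /patch indicE.
  by case: ifP => _; rewrite ?mul1e ?mul0e.
move=> A mA.
have mphiA : measurable (map_tuple phi @^-1` A : set (n.-tuple R[i])).
  by rewrite -[X in measurable X]setTI; exact: mphin.
transitivity (pushforward P X (map_tuple phi @^-1` A)); first by [].
rewrite (PX _ mphiA) (densityE nu _ mphiA) (densityE nu' _ mA).
rewrite (ge0_integral_weight_transport (g := fun x => (\1_A x)%:E));
  last 2 first.
- by apply/measurable_EFinP; exact: measurable_indic.
- by move=> x; rewrite lee_fin.
have Z0 : 0 <= jellium_Z nu n.
  by rewrite integral_ge0// => x _; exact: jellium_weight_ge0.
rewrite ZE (inve_EFinM C0 Z0) [RHS]muleACA -EFinM mulfV ?gt_eqF// mul1e.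
by congr (_ / _); apply: eq_integral.
Qed.

End transport.

(** * Dilations and inversion *)

Lemma measurable_fun_ln_normc (R : realType) :
  measurable_fun [set: R[i]] (fun z => - ln (normc z)).
Proof.
apply: measurableT_comp => //; apply: (measurableT_comp (@measurable_ln R)).
exact: (measurable_normc (@measurable_id _ _ _)).
Qed.

Section log_moment.
Context {R : realType}.
Variable nu : probability R[i] R.
Hypothesis nu_log : log_integrable nu.
Local Open Scope ereal_scope.

Let measurable_log_modulus :
  measurable_fun [set: R[i]] (fun z => `|lne (normc z)%:E|).
Proof.
apply: measurableT_comp => //; apply: measurable_lne.
exact: (measurable_normc (@measurable_id _ _ _)).
Qed.

(** |lne 0| = +oo, so that an atom at 0 would make the logarithmic moment
    infinite. *)
Lemma log_integrable_set0 : nu [set 0%R] = 0.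
Proof.
have [//|nu0] := eqVneq (nu [set 0%R]) 0.
have := nu_log; rewrite /log_integrable ltNge => /negP[].
apply: (@le_trans _ _ (\int[nu]_(z in [set 0%R]) `|lne (normc z)%:E|)).
  rewrite (@eq_integral _ _ _ _ _ (cst +oo)); last first.
    by move=> z /set_mem ->; rewrite normc0 le0_lneNy.
  rewrite integral_cst// gt0_mulye// lt_neqAle eq_sym nu0.
  exact: measure_ge0.
by apply: ge0_subset_integral.
Qed.

(** Here ln 0 = 0, so that this function is finite everywhere. *)
Lemma integrable_ln_normc :
  nu.-integrable [set: R[i]] (fun z => (- ln (normc z))%:E).
Proof.
have mln := @measurable_fun_ln_normc R.
apply/integrableP; split; first exact/measurable_EFinP.
apply: le_lt_trans nu_log; apply: ge0_le_integral => //.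
- by apply/measurable_EFinP; exact: measurableT_comp.
- move=> z _; have [->|z0] := eqVneq z 0%R.
    by rewrite normc0 [X in _ <= `|X|]le0_lneNy//= leey.
  by rewrite lne_EFin ?normc_gt0//= normrN.
Qed.

End log_moment.

Section dilation_inversion.
Context {R : realType}.
Variable nu : probability R[i] R.
Hypotheses (nu_rot : rotation_invariant nu) (nu_log : log_integrable nu).
Local Open Scope ereal_scope.

Lemma image_mulC (u : R[i]) (A : set R[i]) : u != 0%R ->
  [set (u * z)%R | z in A] = (fun z => u^-1 * z)%R @^-1` A.
Proof.
move=> u0; apply/seteqP; split=> [_ [z Az <-]|z /= Az].
  by rewrite /= mulKf.
by exists (u^-1 * z)%R => //; rewrite mulVKf.
Qed.

Lemma normc1_neq0 (u : R[i]) : normc u = 1%R -> u != 0%R.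
Proof.
move=> u1; apply/eqP => u0; move/eqP: u1.
by rewrite u0 normc0 eq_sym oner_eq0.
Qed.

Lemma normc_real (lam : R) : (0 < lam)%R -> normc (real_complex R lam) = lam.
Proof.
by move=> lam0; rewrite /= expr0n addr0 sqrtr_sqr ger0_norm// ltW.
Qed.

Section dil.
Variables (lam : R) (lam_gt0 : (0 < lam)%R).

Let lam0 : real_complex R lam != 0%R.
Proof. by rewrite fmorph_eq0 gt_eqF. Qed.

Lemma dilationE (A : set R[i]) :
  dilation nu lam_gt0 A = nu (scaleby lam @^-1` A).
Proof.
rewrite /dilation; congr (nu _); apply/seteqP; split=> [_ [z Az <-]|z /= Az].
  by rewrite /= /scaleby mulrC divfK.
by exists (scaleby lam z) => //; rewrite /scaleby mulrC mulKf.
Qed.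

Lemma rotation_invariant_dilation : rotation_invariant (dilation nu lam_gt0).
Proof.
move=> u u1 A mA; have u0 := normc1_neq0 u1.
apply: (etrans (dilationE _)); apply: (etrans _ (esym (dilationE _))).
rewrite image_mulC// -[RHS](nu_rot u1); last first.
  by rewrite -[X in measurable X]setTI; exact: measurable_scaleby.
rewrite image_mulC//; congr (nu _); apply/funext => z /=.
by rewrite /scaleby mulrCA.
Qed.

Let mln : measurable_fun setT (fun z : R[i] => lne (normc z)%:E).
Proof.
by apply: measurable_lne; exact: (measurable_normc (@measurable_id _ _ _)).
Qed.

Lemma log_integrable_dilation : log_integrable (dilation nu lam_gt0).
Proof.
rewrite /log_integrable (integral_image_measure (nu := nu) (phi := scaleby lam)).
- apply: (@le_lt_trans _ _ (\int[nu]_z (`|lne (normc z)%:E| + `|ln lam|%:E))).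
    apply: ge0_le_integral => //.
    + apply: measurableT_comp => //.
      exact: (measurableT_comp mln (measurable_scaleby _)).
    + by apply: emeasurable_funD => //; exact: measurableT_comp.
    + move=> z _; rewrite normcM normc_real// -[X in (X * _)%R]lnK ?posrE//.
      rewrite lne_expRM ?normc_ge0//.
      exact: lee_abs_add.
  rewrite ge0_integralD//; last exact: measurableT_comp.
  rewrite integral_cst// [X in _ * X]probability_setT mule1.
  by rewrite lte_add_pinfty// ltry.
- exact: measurable_scaleby.
- by move=> A _; exact: dilationE.
- exact: measurableT_comp.
Qed.

Lemma jellium_dilation n d (Omega : measurableType d) (P : probability Omega R)
    (X : Omega -> n.-tuple R[i]) : is_jellium nu P X ->
  is_jellium (dilation nu lam_gt0) P (fun w => map_tuple (scaleby lam) (X w)).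
Proof.
apply: (@jellium_transport _ nu _ _ (cst (ln lam / 2)%R)) => //.
- exact: measurable_scaleby.
- move=> z w _ _; rewrite /scaleby -mulrBr normcM normc_real//=.
  by rewrite -splitr lnK.
- move=> f mf f0; rewrite -[RHS](ge0_integral_complexM lam0)//.
  apply: eq_integral => z _; rewrite normc_real//; congr (_%:E * _).
  rewrite (_ : (4 * _ = ln lam *+ 2)%R); last by rewrite /=; field.
  by rewrite mulr2n expRD lnK// expr2.
- by move=> A _; exact: dilationE.
- exact: log_integrable_set0.
- exact: finite_measure_integrable_cst.
- exact: rotation_invariant_dilation.
- exact: log_integrable_dilation.
Qed.

End dil.

Let minv : measurable_fun [set: R[i]] inversion := measurable_funPT inversion.

Lemma rotation_invariant_inversion :
  rotation_invariant (distribution nu inversion).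
Proof.
move=> u u1 A mA; have u0 := normc1_neq0 u1.
have v1 : normc (u^-1)%R = 1%R by rewrite normcV u1 invr1.
rewrite /distribution /pushforward image_mulC// -[RHS](nu_rot v1); last first.
  by rewrite -[X in measurable X]setTI; exact: minv.
rewrite image_mulC ?invr_eq0//; congr (nu _); apply/funext => z /=.
by rewrite /inversion invrK invfM.
Qed.

Lemma log_integrable_inversion : log_integrable (distribution nu inversion).
Proof.
have mln : measurable_fun setT (fun z : R[i] => lne (normc z)%:E).
  by apply: measurable_lne; exact: (measurable_normc (@measurable_id _ _ _)).
rewrite /log_integrable (integral_image_measure (nu := nu) (phi := inversion))//.
- rewrite (_ : \int[nu]_z _ = \int[nu]_z `|lne (normc z)%:E|)//.
  apply: eq_integral => z _; have [->|z0] := eqVneq z 0%R.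
    by rewrite /inversion invr0.
  by rewrite /inversion normcV lneV ?normc_gt0// abseN.
- exact: measurableT_comp.
Qed.

Lemma jellium_inversion n d (Omega : measurableType d) (P : probability Omega R)
    (X : Omega -> n.-tuple R[i]) : is_jellium nu P X ->
  is_jellium (distribution nu inversion) P (fun w => map_tuple inversion (X w)).
Proof.
have mln := @measurable_fun_ln_normc R.
apply: (@jellium_transport _ nu _ _ (fun z => (- ln (normc z))%R)) => //.
- move=> z w z0 w0; have [nz nw] := (normc_gt0 z0, normc_gt0 w0).
  rewrite /inversion.
  have -> : (z^-1 - w^-1 = (z * w)^-1 * - (z - w))%R.
    by field; rewrite z0 w0.
  rewrite normcM normcV normcM expRD !expRN !lnK ?posrE// invfM.
  by congr (_ * _)%R; exact: normcN.
- move=> f mf f0; rewrite -[RHS]ge0_integral_inversion//.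
  (* since ln 0 = 0 and 0^-1 = 0, the factors e^(- 4 ln |z|) and |z|^(-4)
     differ at the origin *)
  have mfi := measurableT_comp mf minv.
  rewrite -[LHS](ge0_integral_neq0C lebesgueC_set0); last 2 first.
  + apply: emeasurable_funM => //; apply/measurable_EFinP.
    apply: measurableT_comp; first exact: measurable_expR.
    by apply: measurable_funM => //; exact: mln.
  + by move=> z; rewrite mule_ge0// lee_fin expR_ge0.
  rewrite -[RHS](ge0_integral_neq0C lebesgueC_set0); last 2 first.
  + apply: emeasurable_funM => //; apply/measurable_EFinP.
    under eq_fun do rewrite -exprVn -normcV.
    by apply: measurable_funX; apply: measurable_normc; exact: minv.
  + by move=> z; rewrite mule_ge0// lee_fin invr_ge0 exprn_ge0// normc_ge0.
  apply: eq_integral => z _; rewrite neq0CE.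
  have [//|z0] := eqVneq z 0%R; first by rewrite !mul0e.
  rewrite !mul1e; congr (_%:E * _).
  by rewrite mulrN mulr_natl expRN -mulr_natl expRM_natl lnK ?posrE ?normc_gt0.
- exact: log_integrable_set0.
- exact: integrable_ln_normc.
- exact: rotation_invariant_inversion.
- exact: log_integrable_inversion.
Qed.

End dilation_inversion.

Theorem theorem1p13 (R : realType) (nu : probability R[i] R)
    (nu_rot : rotation_invariant nu) (nu_log : log_integrable nu)
    (n : nat) (n_ge1 : (1 <= n)%N)
    (d : measure_display) (Omega : measurableType d) (P : probability Omega R)
    (X : Omega -> n.-tuple R[i]) (X_jellium : is_jellium nu P X) :
  (forall (lam : R) (lam_gt0 : 0 < lam),
     is_jellium (dilation nu lam_gt0) P
       (fun w => map_tuple (scaleby lam) (X w))) /\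
  is_jellium (distribution nu inversion) P
    (fun w => map_tuple inversion (X w)).
Proof.
split=> [lam lam_gt0|]; first exact: jellium_dilation.
exact: jellium_inversion.
Qed.
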